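(* Let $r\ge1$. There exists a finite positive Borel measure $\mu$ on the hyperbolic plane $\mathbb{H}^2$ such that $$\int_{\mathbb{H}^2}d(x,x_0)^p\,d\mu(x)<\infty\qquad\forall\,p>0,\ \forall\,x_0\in\mathbb{H}^2,$$ but $$N^{r/2}\,V_{N,r}(\mu)\to\infty\qquad\text{as }N\to\infty.$$
   Context: $\mathbb{H}^2$ is the hyperbolic plane (constant curvature $-1$) with Riemannian distance $d$. For a finite positive measure $\mu$ on $\mathbb{H}^2$, an integer $N\ge1$ and $r\ge1$, $$V_{N,r}(\mu):=\inf_{\alpha\subset\mathbb{H}^2:\,|\alpha|\le N}\int_{\mathbb{H}^2}\min_{a\in\alpha}d(a,y)^r\,d\mu(y),$$ where $\alpha$ ranges over nonempty finite subsets and $|\alpha|$ is the cardinality. *)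

(* Defs.v *)
From HB Require Import structures.
From mathcomp Require Import all_boot all_order all_algebra finmap.
From mathcomp Require Import all_classical all_reals all_analysis.

Set Implicit Arguments.
Unset Strict Implicit.
Unset Printing Implicit Defensive.

Import Order.TTheory GRing.Theory Num.Theory.
Import numFieldTopology.Exports numFieldNormedType.Exports.

Local Open Scope classical_set_scope.
Local Open Scope ring_scope.

(* Upper half-plane model {(x, y) | y > 0}, with the Riemannian metric
   (dx^2 + dy^2) / y^2, whose Gaussian curvature is -1. *)
Definition hyp_plane (R : realType) : Type := {z : R * R | 0 < z.2}.

HB.instance Definition _ (R : realType) := Choice.on (hyp_plane R).

Definition hyp_base (R : realType) : hyp_plane R :=
  exist (fun z : R * R => 0 < z.2) (0, 1) ltr01.

HB.instance Definition _ (R : realType) :=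
  isPointed.Build (hyp_plane R) (hyp_base R).

Section hyperbolic_distance.
Variable R : realType.
Implicit Types (p q s : hyp_plane R) (u v : R -> R).

(* A C^1 function on [0, 1] is encoded as the restriction of a C^1 function on
   the whole line, which avoids one-sided derivatives at the endpoints. *)
Definition is_C1 (f : R -> R) : Prop :=
  (forall t, derivable f t 1) /\ continuous f^`()%classic.

Definition C1_arc p q u v : Prop :=
  [/\ is_C1 u, is_C1 v,
      forall t, t \in `[0, 1] -> 0 < v t,
      (u 0, v 0) = \val p & (u 1, v 1) = \val q].

Definition arc_length u v : R :=
  \int[lebesgue_measure]_(t in `[0, 1])
     (Num.sqrt (u^`()%classic t ^+ 2 + v^`()%classic t ^+ 2) / v t).

(* [pw_C1_curve p q L]: some piecewise C^1 curve from p to q, that is, a finite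
   concatenation of C^1 arcs (each parametrized by [0, 1]), has length L. *)
Inductive pw_C1_curve p : hyp_plane R -> R -> Prop :=
| pw_C1_const : pw_C1_curve p p 0
| pw_C1_rcons q s L u v :
    pw_C1_curve p q L -> C1_arc q s u v ->
    pw_C1_curve p s (L + arc_length u v).

(* The set is nonempty and bounded below by 0, so that [inf] is the genuine
   infimum. *)
Definition hyp_dist p q : R := inf [set L | pw_C1_curve p q L].

Definition hyp_open (U : set (hyp_plane R)) : Prop :=
  forall p, U p -> exists2 e : R, 0 < e & [set q | hyp_dist p q < e] `<=` U.

End hyperbolic_distance.

(* The hyperbolic plane carries its Borel sigma-algebra. *)
HB.instance Definition _ (R : realType) :=
  Measurable.copy (hyp_plane R) (g_sigma_algebraType (@hyp_open R)).

(* The minimum over the nonempty finite set [alpha] is taken in the extended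
   reals, with neutral element +oo. *)
Definition quantization_error (R : realType) (N : nat) (r : R)
    (mu : {finite_measure set (hyp_plane R) -> \bar R}) : \bar R :=
  ereal_inf [set \int[mu]_y
                   \big[Order.min/+oo%E]_(a <- alpha) (hyp_dist a y `^ r)%:E
            | alpha in [set alpha : {fset hyp_plane R} |
                        alpha != fset0 /\ (#|` alpha| <= N)%N]]%E.

(* Main.v *)
Require Import Defs.
From HB Require Import structures.
From mathcomp Require Import all_boot all_order all_algebra finmap.
From mathcomp Require Import all_classical all_reals all_analysis.
From mathcomp Require Import measurable_realfun ring lra.

(** The measure is a sum of point masses on a horocycle: the point (n, 1) of
    the half-plane carries the mass (n + 1) ^ (- 5/4).

    Horocycles are exponentially distorted.  The path that climbs from (n, 1)
    to height n + 1, moves sideways there and comes down again shows that the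
    distance from (n, 1) to a fixed point is at most 2 ln (n + 1) + C
    ([hyp_dist_atom_le]).  Every power of this distance is therefore
    O((n + 1) ^ (1/8)), and all moments are dominated by the convergent series
    of the (n + 1) ^ (- 9/8) ([heavy_tailed_moment]).

    On the other hand the points (n, 1) are uniformly separated: a centre lies
    within [separation] of at most one of them ([atom_separated]).  Any N
    centres miss N of the first 2N points, each of mass at least
    (2N) ^ (- 5/4), so that V_(N,r) is at least a constant times N ^ (- 1/4)
    ([quantization_error_ge]).  As r / 2 >= 1 / 2, the product
    N ^ (r/2) V_(N,r) grows at least like N ^ (1/4).

    Separation rests on one explicit function.  The function ln (2 cosh d),
    where d is the distance to (c, 1), has the closed form [ln2cosh] and a
    gradient of hyperbolic norm tanh d <= 1; integrating along arcs makes it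
    1-Lipschitz for [hyp_dist] ([ln2cosh_lipschitz]).  It takes the value ln 2
    at (n, 1) and at least ln 3 at every other (m, 1) when c = n.  Since a
    point a satisfies |F a - F p| <= hyp_dist a p for F = [ln2cosh n], the two
    distances from a to (n, 1) and to (m, 1) add up to at least ln 3 - ln 2.
    The function F thus replaces a comparison of (n, 1) with (m, 1) through a
    by two comparisons that both start at a, as the distances from a centre
    to the atoms do.

    Integrals of functions of the distance are bounded directly through simple
    functions ([le_integral_atomic_measure], [ge_integral_atomic_measure]):
    for a discrete measure with measurable atoms, both bounds hold for an
    arbitrary nonnegative integrand. *)

Set Implicit Arguments.
Unset Strict Implicit.
Unset Printing Implicit Defensive.
Import Order.TTheory GRing.Theory Num.Theory.
Import numFieldTopology.Exports numFieldNormedType.Exports.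
Local Open Scope classical_set_scope.
Local Open Scope ring_scope.

(** * A function whose hyperbolic gradient is bounded by one *)

Section lncosh.
Variable R : realType.
Implicit Types (c : R) (z : R * R).

(** This is ln (2 cosh d), where d is the hyperbolic distance from (c, 1) to
    [z], because cosh d = ((z.1 - c)^2 + z.2^2 + 1) / (2 z.2). *)
Definition ln2cosh c z : R := ln ((z.1 - c) ^+ 2 + z.2 ^+ 2 + 1) - ln z.2.

(** The inner product of the gradient with a tangent vector (a, b) at (c + w, v).
    By Cauchy-Schwarz it suffices that the hyperbolic norm of the gradient is
    at most 1; its square is 1 - 4 v^2 / (w^2 + v^2 + 1)^2. *)
Lemma ln2cosh_gradient (w v a b : R) : 0 < v ->
  `|(2 * w * a + 2 * v * b) / (w ^+ 2 + v ^+ 2 + 1) - b / v|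
    <= Num.sqrt (a ^+ 2 + b ^+ 2) / v.
Proof.
move=> v0; set A := w ^+ 2 + v ^+ 2 + 1.
have A0 : 0 < A by rewrite ltr_wpDl// addr_ge0 ?sqr_ge0.
have -> : (2 * w * a + 2 * v * b) / A - b / v =
    (2 * w * v * a + (2 * v ^+ 2 - A) * b) / A / v.
  by field; rewrite !gt_eqF.
rewrite !normrM (gtr0_norm (x := v^-1)) ?invr_gt0// ler_pM2r ?invr_gt0//.
rewrite normfV (gtr0_norm A0) ler_pdivrMr// -sqrtr_sqr.
have -> : Num.sqrt (a ^+ 2 + b ^+ 2) * A = Num.sqrt ((a ^+ 2 + b ^+ 2) * A ^+ 2).
  by rewrite sqrtrM ?addr_ge0 ?sqr_ge0// sqrtr_sqr gtr0_norm.
rewrite ler_sqrt ?mulr_ge0 ?addr_ge0 ?sqr_ge0// -subr_ge0.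
(* Lagrange's identity for the vectors (a, b) and (2 w v, 2 v^2 - A), together
   with A^2 - (2 w v)^2 - (2 v^2 - A)^2 = (2 v)^2. *)
have -> : (a ^+ 2 + b ^+ 2) * A ^+ 2 -
    (2 * w * v * a + (2 * v ^+ 2 - A) * b) ^+ 2 =
    (2 * v) ^+ 2 * (a ^+ 2 + b ^+ 2) +
    (2 * w * v * b - (2 * v ^+ 2 - A) * a) ^+ 2 by rewrite /A; ring.
apply: addr_ge0; [apply: mulr_ge0; [|apply: addr_ge0]|]; exact: sqr_ge0.
Qed.

Lemma is_derive_ln2cosh c (u v : R -> R) (t du dv : R) : 0 < v t ->
  is_derive t 1 u du -> is_derive t 1 v dv ->
  is_derive t 1 (fun t => ln2cosh c (u t, v t))
    ((2 * (u t - c) * du + 2 * v t * dv) / ((u t - c) ^+ 2 + v t ^+ 2 + 1)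
      - dv / v t).
Proof.
move=> vt0 udu vdv.
have A0 : 0 < (u t - c) ^+ 2 + v t ^+ 2 + 1.
  by rewrite ltr_wpDl// addr_ge0 ?sqr_ge0.
pose A := (u - cst c) ^+ 2 + v ^+ 2 + cst 1.
have dlnA := @is_derive1_comp R (@ln R) A t _ _ (is_derive1_ln A0) _.
have dlnv := @is_derive1_comp R (@ln R) v t _ _ (is_derive1_ln vt0) vdv.
have -> : (fun t => ln2cosh c (u t, v t)) = (@ln R \o A) - (@ln R \o v).
  by [].
apply: is_derive_eq.
rewrite /= !fctE/= /GRing.scale/= subr0 addr0 !expr1.
rewrite [_^-1 * _]mulrC [_^-1 * dv]mulrC.
by congr (_ / _ - _); ring.
Qed.
End lncosh.

(** * Arcs cannot be shorter than the variation of that function *)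

Section arcs.
Variable R : realType.
Implicit Types (c L : R) (p q : hyp_plane R) (u v : R -> R).

Lemma is_C1_is_derive u (t : R) : is_C1 u -> is_derive t 1 u (u^`()%classic t).
Proof. by move=> [du _]; rewrite derive1E; apply/derivableP. Qed.

Lemma is_C1_continuous u (t : R) : is_C1 u -> {for t, continuous u}.
Proof.
by move=> [du _]; apply/differentiable_continuous/derivable1_diffP.
Qed.

Lemma continuous_at_sqr u (t : R) : {for t, continuous u} ->
  {for t, continuous (fun s => u s ^+ 2)}.
Proof.
by move=> cu; exact: (cvgM cu cu).
Qed.

Lemma integrable_speed p q u v : C1_arc p q u v ->
  (@lebesgue_measure R).-integrable `[0, 1] (EFin \o (fun t =>
    Num.sqrt (u^`()%classic t ^+ 2 + v^`()%classic t ^+ 2) / v t)).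
Proof.
move=> [Cu Cv v0 _ _]; apply: continuous_compact_integrable.
  exact: segment_compact.
apply: continuous_in_subspaceT => t /[1!inE] /v0 vt0.
apply: cvgM; last by apply: cvgV; [rewrite gt_eqF|exact: is_C1_continuous].
apply: continuous_comp; last exact: sqrt_continuous.
by apply: cvgD; apply: continuous_at_sqr; [exact: Cu.2|exact: Cv.2].
Qed.

(** The difference of the endpoint values is the integral of the derivative along
    the arc, and [ln2cosh_gradient] bounds that derivative by the speed. *)
Lemma ln2cosh_arc_length c p q u v : C1_arc p q u v ->
  `|ln2cosh c (\val q) - ln2cosh c (\val p)| <= arc_length u v.
Proof.
move=> puvq; have [Cu Cv v0 <- <-] := puvq.
pose g t := ln2cosh c (u t, v t).
pose g' t := (2 * (u t - c) * u^`()%classic t + 2 * v t * v^`()%classic t)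
  / ((u t - c) ^+ 2 + v t ^+ 2 + 1) - v^`()%classic t / v t.
have dg (t : R) : t \in `[0, 1] -> is_derive t 1 g (g' t).
  by move=> /v0 vt0; apply: is_derive_ln2cosh => //; exact: is_C1_is_derive.
have cg (t : R) : t \in `[0, 1] -> {for t, continuous g}.
  move=> /dg dgt; apply/differentiable_continuous/derivable1_diffP.
  exact: ex_derive.
have cg' : {within `[0, 1], continuous g'}.
  apply: continuous_in_subspaceT => t /[1!inE] /v0 vt0.
  have cu := @is_C1_continuous u t Cu.
  have cv := @is_C1_continuous v t Cv.
  have cuc : {for t, continuous (fun t => u t - c)}.
    by apply: cvgB => //; exact: cvg_cst.
  apply: cvgB; apply: cvgM.
  - apply: cvgD; apply: cvgM.
    + by apply: cvgM => //; exact: cvg_cst.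
    + exact: Cu.2.
    + by apply: cvgM => //; exact: cvg_cst.
    + exact: Cv.2.
  - apply: cvgV; first by rewrite gt_eqF// ltr_wpDl// addr_ge0 ?sqr_ge0.
    by apply: cvgD; [apply: cvgD|exact: cvg_cst];
      [exact: (continuous_at_sqr cuc)|exact: (continuous_at_sqr cv)].
  - exact: Cv.2.
  - by apply: cvgV => //; rewrite gt_eqF.
have ig' : (@lebesgue_measure R).-integrable `[0, 1] (EFin \o g').
  by apply: continuous_compact_integrable => //; exact: segment_compact.
have <- : \int[lebesgue_measure]_(t in `[0, 1]) g' t = g 1 - g 0.
  rewrite /Rintegral (@continuous_FTC2 _ g' g)//.
  - split.
    + by move=> t /subset_itv_oo_cc /dg ?; exact: ex_derive.
    + by apply: cvg_at_right_filter; apply: cg; rewrite in_itv/= lexx ler01.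
    + by apply: cvg_at_left_filter; apply: cg; rewrite in_itv/= lexx ler01.
  - move=> t /subset_itv_oo_cc /dg ?; rewrite derive1E; exact: derive_val.
apply: (le_trans (le_normr_Rintegral _ ig')) => //.
apply: le_Rintegral => //.
- exact: (integrable_norm ig').
- exact: integrable_speed puvq.
- by move=> t /v0 vt0; exact: ln2cosh_gradient.
Qed.

End arcs.

(** * Hyperbolic distance: upper and lower bounds *)

Section distance.
Variable R : realType.
Implicit Types (c L x y h : R) (p q : hyp_plane R) (u v : R -> R).

Lemma is_C1_of_derive u u' : (forall t : R, is_derive t 1 u (u' t)) ->
  continuous u' -> is_C1 u /\ u^`()%classic = u'.
Proof.
move=> du cu'.
have uE : u^`()%classic = u'.
  by apply/funext => t; rewrite derive1E; exact: derive_val.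
by split=> //; split=> [t|]; [exact: ex_derive|rewrite uE].
Qed.

Lemma is_derive_affine x y (t : R) : is_derive t 1 (fun t => x + t * y) y.
Proof.
have -> : (fun t => x + t * y) = cst x + (y \*: (@id R)).
  by apply/funext => s; rewrite /= mulrC.
by apply: is_derive_eq; rewrite add0r /GRing.scale/= mulr1.
Qed.

Lemma arc_length_cst u v h :
  (forall t, t \in `[0, 1] ->
    Num.sqrt (u^`()%classic t ^+ 2 + v^`()%classic t ^+ 2) / v t = h) ->
  arc_length u v = h.
Proof.
move=> uvh; rewrite /arc_length (@eq_Rintegral _ _ _ _ _ (cst h)); last first.
  by move=> t /[1!inE]; exact: uvh.
rewrite Rintegral_cst//= lebesgue_measure_itv/= lte_fin ltr01.
by rewrite oppr0 adde0 mulr1.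
Qed.

Definition hyp_point x y (y0 : 0 < y) : hyp_plane R :=
  exist (fun z : R * R => 0 < z.2) (x, y) y0.

(** The exponential parametrization has constant hyperbolic speed. *)
Lemma vertical_arc x y h (y0 : 0 < y) (h0 : 0 < h) :
  exists u v, C1_arc (hyp_point x y0) (hyp_point x h0) u v /\
    arc_length u v = `|ln h - ln y|.
Proof.
have [Cu u'E] : is_C1 (cst x : R -> R) /\ (cst x)^`()%classic = cst (0 : R).
  apply: (@is_C1_of_derive _ (cst 0)) => t; exact: cvg_cst.
pose k := ln h - ln y; pose v t := expR (ln y + t * k).
have dv (t : R) : is_derive t 1 v (v t * k).
  apply: is_derive1_comp; exact: is_derive_affine.
have [Cv v'E] : is_C1 v /\ v^`()%classic = fun t => v t * k.
  apply: is_C1_of_derive => // t; apply: cvgM; last exact: cvg_cst.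
  apply/differentiable_continuous/derivable1_diffP.
  by have := dv t => ?; exact: ex_derive.
exists (cst x), v; split.
  split => //= [t _|/=|/=]; first exact: expR_gt0.
    by rewrite /v mul0r addr0 lnK ?posrE.
  by rewrite /v mul1r /k addrC subrK lnK ?posrE.
apply: arc_length_cst => t _; rewrite u'E v'E /= expr0n/= add0r sqrtr_sqr.
by rewrite normrM gtr0_norm ?expR_gt0// mulrC mulKf// gt_eqF ?expR_gt0.
Qed.

Lemma horizontal_arc x y h (h0 : 0 < h) :
  exists u v, C1_arc (hyp_point x h0) (hyp_point y h0) u v /\
    arc_length u v = `|y - x| / h.
Proof.
have [Cv v'E] : is_C1 (cst h : R -> R) /\ (cst h)^`()%classic = cst (0 : R).
  apply: (@is_C1_of_derive _ (cst 0)) => t; exact: cvg_cst.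
pose u t := x + t * (y - x).
have [Cu u'E] : is_C1 u /\ u^`()%classic = cst (y - x).
  apply: (@is_C1_of_derive _ (cst (y - x))) => t.
    exact: is_derive_affine.
  exact: cvg_cst.
exists u, (cst h); split.
  by split => //=; rewrite /u ?mul0r ?addr0// mul1r addrC subrK.
apply: arc_length_cst => t _.
by rewrite u'E v'E /= expr0n/= addr0 sqrtr_sqr.
Qed.

Lemma pw_C1_curve_ge0 p q L : pw_C1_curve p q L -> 0 <= L.
Proof.
elim=> // {}q s {}L u v _ L0 [_ _ v0 _ _]; rewrite addr_ge0//.
by apply: Rintegral_ge0 => t /v0 vt0; rewrite divr_ge0 ?sqrtr_ge0// ltW.
Qed.

Lemma hyp_dist_le p q L : pw_C1_curve p q L -> hyp_dist p q <= L.
Proof.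
move=> pqL; apply: ge_inf => //.
by exists 0 => M /=; exact: pw_C1_curve_ge0.
Qed.

(** Climbing to height [h] before moving sideways divides the cost of the
    sideways move by [h]; with [h] of the order of the Euclidean distance the
    total is logarithmic in that distance. *)
Lemma three_arc_curve p q h : 0 < h ->
  pw_C1_curve p q (`|ln h - ln (\val p).2| +
    `|(\val q).1 - (\val p).1| / h + `|ln (\val q).2 - ln h|).
Proof.
case: p q => -[x y] /= y0 [[x' y'] /= y'0] h0.
have [u1 [v1 [a1 <-]]] := vertical_arc x y0 h0.
have [u2 [v2 [a2 <-]]] := horizontal_arc x x' h0.
have [u3 [v3 [a3 <-]]] := vertical_arc x' h0 y'0.
apply: (pw_C1_rcons _ a3); apply: (pw_C1_rcons _ a2).
rewrite -[X in pw_C1_curve _ _ X]add0r; apply: pw_C1_rcons a1.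
exact: pw_C1_const.
Qed.

(** The infimum of the empty set is 0, so this needs the existence of a curve
    between any two points, which [three_arc_curve] provides. *)
Lemma lb_le_hyp_dist p q x : (forall L, pw_C1_curve p q L -> x <= L) ->
  x <= hyp_dist p q.
Proof.
move=> xL; apply: lb_le_inf => //; eexists.
exact: (three_arc_curve p q ltr01).
Qed.

Lemma hyp_dist_ge0 p q : 0 <= hyp_dist p q.
Proof. by apply: lb_le_hyp_dist => L; exact: pw_C1_curve_ge0. Qed.

(** The bound for single arcs adds up along a concatenation. *)
Lemma ln2cosh_lipschitz c p q :
  `|ln2cosh c (\val q) - ln2cosh c (\val p)| <= hyp_dist p q.
Proof.
apply: lb_le_hyp_dist => L; elim=> [|{}q s {}L u v _ IH qs].
  by rewrite subrr normr0.
rewrite (le_trans (ler_distD (ln2cosh c (\val q)) _ _))// addrC lerD//.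
exact: ln2cosh_arc_length.
Qed.

End distance.

(** * Riemann series and powers against exponentials *)

Section riemann_series.
Variable R : realType.

(** A discrete form of the fact that - x ^ (- s) is a primitive of
    s x ^ (- 1 - s); it follows from (b / a) ^ s >= 1 + s ln (b / a) and
    ln (b / a) >= 1 / b for b = a + 1. *)
Lemma riemannR_telescope (s : R) n : 0 < s ->
  s * riemannR (1 + s) n.+1 <= riemannR s n - riemannR s n.+1.
Proof.
move=> s0; rewrite /riemannR; set a : R := n.+1%:R; set b : R := n.+2%:R.
have a0 : 0 < a by rewrite ltr0n.
have b0 : 0 < b by rewrite ltr0n.
have ab : a = b - 1 by rewrite /a /b -[n.+2%:R]natr1 addrK.
have b1 : 1 < b by rewrite ltr1n.
have lnab : b^-1 <= ln b - ln a.
  rewrite -ln_div ?posrE// -lerN2 -lnV ?posrE ?divr_gt0// invf_div.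
  have -> : a / b = 1 + - b^-1 by rewrite ab; field; rewrite gt_eqF.
  by apply: le_ln1Dx; rewrite ltrN2 invf_lt1.
have ba : 1 + s / b <= b `^ s / a `^ s.
  rewrite /powR !gt_eqF// -expRN -expRD -mulrBr.
  by rewrite (le_trans _ (expR_ge1Dx _))// lerD2l ler_pM2l.
have -> : b `^ (1 + s) = b * b `^ s.
  by rewrite powRD ?powRr1 ?(ltW b0)// (gt_eqF b0) implybT.
rewrite lerBrDr.
have as0 : 0 < a `^ s by rewrite powR_gt0.
have bs0 : 0 < b `^ s by rewrite powR_gt0.
have -> : s * (b * b `^ s)^-1 + (b `^ s)^-1 = (1 + s / b) / b `^ s.
  by field; rewrite !gt_eqF.
by rewrite ler_pdivrMr// [leRHS]mulrC.
Qed.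

Lemma riemannR_summable (s : R) : 0 < s ->
  (\sum_(0 <= n <oo) (riemannR (1 + s) n)%:E < +oo)%E.
Proof.
move=> s0; have w0 n : 0 <= riemannR (1 + s) n.
  by rewrite ltW// riemannR_gt0// addr_ge0// ltW.
have partial M : s * \sum_(0 <= n < M.+1) riemannR (1 + s) n
    <= s + 1 - riemannR s M.
  elim: M => [|M IH]; first
    by rewrite big_nat1 /riemannR !powR1 invr1 mulr1 addrK.
  rewrite big_nat_recr//= mulrDr; have := riemannR_telescope M s0; lra.
apply: (@le_lt_trans _ _ (1 + s^-1)%:E); last exact: ltry.
apply: lime_le; first by apply: is_cvg_nneseries => n _ _; rewrite lee_fin.
apply: nearW => M; rewrite sumEFin lee_fin.
apply: (@le_trans _ _ (\sum_(0 <= n < M.+1) riemannR (1 + s) n)).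
  by rewrite big_nat_recr//= lerDl.
rewrite -(ler_pM2l s0) mulrDr mulfV ?gt_eqF// mulr1.
by rewrite (le_trans (partial M))// gerBl ltW// riemannR_gt0// ltW.
Qed.

(** Apply t <= exp t to t = e x / p and raise to the power p. *)
Lemma powR_le_expR (x p e : R) : 0 <= x -> 0 < p -> 0 < e ->
  x `^ p <= (p / e) `^ p * expR (e * x).
Proof.
move=> x0 p0 e0.
have xle : x <= p / e * expR (e * x / p).
  apply: (@le_trans _ _ (p / e * (e * x / p))).
    by rewrite le_eqVlt; apply/orP; left; apply/eqP; field; rewrite !gt_eqF.
  rewrite ler_pM2l ?divr_gt0// (le_trans _ (expR_ge1Dx _))//.
  by rewrite lerDr ler01.
rewrite (le_trans (ge0_ler_powR (ltW p0) _ _ xle))// ?nnegrE//.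
  by rewrite mulr_ge0 ?expR_ge0// divr_ge0 ?ltW.
rewrite powRM ?expR_ge0 ?(ltW (divr_gt0 p0 e0))//.
have -> // : expR (e * x / p) `^ p = expR (e * x).
by rewrite /powR gt_eqF ?expR_gt0// expRK mulrC divfK ?gt_eqF.
Qed.
End riemann_series.

(** * Purely atomic measures *)

Section atomic_measure.
Context d (T : measurableType d) (R : realType).
Variables (w : nat -> {nonneg R}) (x : nat -> T).
Local Open Scope ereal_scope.

Definition atomic_measure : set T -> \bar R :=
  mseries (fun n => mscale (w n) (dirac (x n))) 0.

HB.instance Definition _ := Measure.on atomic_measure.

Lemma atomic_measureE (A : set T) :
  atomic_measure A = \sum_(0 <= n <oo) (w n)%:num%:E * (\1_A (x n))%:E.
Proof. by []. Qed.

Lemma atomic_measure_setT :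
  atomic_measure setT = \sum_(0 <= n <oo) (w n)%:num%:E.
Proof.
by rewrite atomic_measureE; apply: eq_eseriesr => n _; rewrite indicT mule1.
Qed.

Import HBNNSimple.

(** The integral of a nonnegative function is a supremum over the simple functions
    below it, and a simple function is measurable, so that its integral is the
    sum over the atoms.  Hence [f] may be any nonnegative function. *)
Lemma le_integral_atomic_measure (f : T -> \bar R) : (forall y, 0 <= f y) ->
  \int[atomic_measure]_y f y <= \sum_(0 <= n <oo) (w n)%:num%:E * f (x n).
Proof.
move=> f0; rewrite ge0_integralTE//; apply: ge_ereal_sup => _ [h /= hf <-].
rewrite -integralT_nnsfun (integral_measure_series_nnsfun _ measurableT).
apply: lee_nneseries => [n _ _|n _].
  by apply: integral_ge0 => y _; rewrite lee_fin.
rewrite ge0_integral_mscale//=; last 2 first.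
  - exact/measurable_EFinP.
  - by move=> y _; rewrite lee_fin.
rewrite integral_dirac//; last exact/measurable_EFinP.
by rewrite diracT mul1e lee_wpmul2l// lee_fin.
Qed.

(** The simple function [k] times the indicator of finitely many atoms lies below
    [f], so that [f] may again be any nonnegative function. *)
Lemma ge_integral_atomic_measure (f : T -> \bar R) (k : R) (P : pred nat) M :
  (forall n, d.-measurable [set x n]) ->
  (forall y, 0 <= f y) -> (0 <= k)%R ->
  (forall n, (n < M)%N -> P n -> k%:E <= f (x n)) ->
  k%:E * (\sum_(0 <= n < M | P n) (w n)%:num)%:E <= \int[atomic_measure]_y f y.
Proof.
move=> mx f0 k0 kf.
pose B := \big[setU/set0]_(0 <= n < M | P n) [set x n].
have mB : measurable B by exact: bigsetU_measurable.
have BP y : B y -> exists n, [/\ (n < M)%N, P n & y = x n].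
  rewrite /B -bigcup_seq_cond => -[n /= /andP[]].
  by rewrite mem_index_iota => nM Pn ->; exists n.
have xB n : (n < M)%N -> P n -> x n \in B.
  move=> nM Pn; rewrite inE /B -bigcup_seq_cond; exists n => //=.
  by rewrite mem_index_iota nM.
pose h := scale_nnsfun (indic_nnsfun R mB) k0.
have hf y : (h y)%:E <= f y.
  rewrite /h/= mindicE; have [/[1!inE]|] := boolP (y \in B).
    by move=> /BP[n [nM Pn ->]]; rewrite mulr1; exact: kf.
  by rewrite mulr0.
rewrite ge0_integralTE//; apply: le_ereal_sup_tmp.
exists (sintegral atomic_measure h); first by exists h.
rewrite sintegralrM sintegral_indic lee_wpmul2l//.
rewrite -[leRHS]/(atomic_measure B) atomic_measureE.
apply: le_trans; last first.
  by apply: (nneseries_lim_ge M) => n _ _; rewrite mule_ge0 ?lee_fin.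
rewrite -sumEFin [leLHS]big_mkcond/= !big_mkord; apply: lee_sum => n _.
case: ifPn => Pn; last by rewrite mule_ge0 ?lee_fin.
by rewrite indicE xB ?mule1//.
Qed.

End atomic_measure.

(** * Integer points of a horocycle *)

Section atoms.
Variable R : realType.
Implicit Types (p q a : hyp_plane R).

Definition atom (n : nat) : hyp_plane R := hyp_point n%:R ltr01.

Lemma ln2cosh_atom n m :
  ln2cosh n%:R (\val (atom m)) = ln ((m%:R - n%:R) ^+ 2 + 2 : R).
Proof. by rewrite /ln2cosh/= ln1 subr0 expr1n; congr ln; ring. Qed.

(** Half of the least difference between the values of [ln2cosh n] at the atom
    [n] and at another atom. *)
Definition separation : R := (ln 3 - ln 2) / 2.

Lemma separation_gt0 : 0 < separation.
Proof. by rewrite divr_gt0// subr_gt0 ltr_ln ?posrE// ltr_nat. Qed.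

(** With F = [ln2cosh n], the two distances from [a] are at least
    |F (atom n) - F a| and |F (atom m) - F a|, whose sum is at least
    F (atom m) - F (atom n) >= ln 3 - ln 2. *)
Lemma atom_separated a n m : n != m ->
  hyp_dist a (atom n) < separation -> separation <= hyp_dist a (atom m).
Proof.
move=> nm an.
have lipn := ln2cosh_lipschitz n%:R a (atom n).
have lipm := ln2cosh_lipschitz n%:R a (atom m).
rewrite ln2cosh_atom in lipm; rewrite ln2cosh_atom subrr expr0n/= add0r in lipn.
have ln3 : ln 3 <= ln ((m%:R - n%:R) ^+ 2 + 2 : R).
  rewrite ler_ln ?posrE ?ltr_wpDl ?sqr_ge0//.
  suff : 1 <= (m%:R - n%:R) ^+ 2 :> R by lra.
  rewrite -real_normK ?num_real// exprn_ege1//.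
  have [mn|nm'|mn] := ltngtP m n; last by rewrite mn eqxx in nm.
    by rewrite distrC -natrB 1?ltnW// normr_nat ler1n subn_gt0.
  by rewrite -natrB 1?ltnW// normr_nat ler1n subn_gt0.
have := ler_norm (ln 2 - ln2cosh n%:R (\val a)).
have := ler_norm (ln2cosh n%:R (\val a) - ln 2); rewrite distrC.
have := ler_norm (ln ((m%:R - n%:R) ^+ 2 + 2) - ln2cosh n%:R (\val a)).
move: an; rewrite /separation; lra.
Qed.

(** The complement of an atom is open: [ln2cosh n] is minimal exactly at the atom
    [n], and its excess at a point bounds the distance from that point to the
    atom from below. *)
Lemma measurable_atom n : measurable [set atom n].
Proof.
rewrite -[X in measurable X]setCK; apply: measurableC.
apply: sub_sigma_algebra => -[[x y] /= y0] /= xy.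
have xyn : (x - n%:R) ^+ 2 + (y - 1) ^+ 2 != 0.
  rewrite paddr_eq0 ?sqr_ge0// !sqrf_eq0 !subr_eq0.
  apply/negP => /andP[/eqP xn /eqP y1]; apply: xy.
  by apply: eq_exist => /=; rewrite xn y1.
have {xyn} xyn : 0 < (x - n%:R) ^+ 2 + (y - 1) ^+ 2.
  by rewrite lt0r xyn addr_ge0 ?sqr_ge0.
set p := exist _ (x, y) y0.
exists (ln2cosh n%:R (\val p) - ln2cosh n%:R (\val (atom n))).
  rewrite ln2cosh_atom subrr expr0n/= add0r subr_gt0 /ln2cosh/=.
  rewrite -ln_div ?posrE ?ltr_wpDl ?addr_ge0 ?sqr_ge0//.
  rewrite ltr_ln ?posrE ?divr_gt0 ?ltr_wpDl ?addr_ge0 ?sqr_ge0//.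
  by rewrite ltr_pdivlMr//; nra.
move=> q /= pq qn; move: pq; rewrite qn ltNge => /negP; apply.
by rewrite (le_trans _ (ln2cosh_lipschitz n%:R _ _))// distrC ler_norm.
Qed.

(** The curve of [three_arc_curve] through the height n + 1. *)
Lemma hyp_dist_atom_le p : exists C,
  forall n, hyp_dist (atom n) p <= C + 2 * ln n.+1%:R.
Proof.
case: p => -[x y] /= y0; exists (`|x| + 1 + `|ln y|) => n.
have n0 : 0 < n.+1%:R :> R by rewrite ltr0n.
apply: (le_trans (hyp_dist_le (three_arc_curve _ _ n0))) => /=.
have ln0 : 0 <= ln n.+1%:R :> R by rewrite ln_ge0// ler1n.
rewrite ln1 subr0 (ger0_norm ln0).
have xn : `|x - n%:R| / n.+1%:R <= `|x| + 1.
  rewrite ler_pdivrMr// (le_trans (ler_normB _ _))// normr_nat.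
  have : 0 <= `|x| * n%:R by rewrite mulr_ge0.
  rewrite -natr1. lra.
have := ler_normB (ln y) (ln n.+1%:R); rewrite (ger0_norm ln0).
by move: xn; set X := _ / _; lra.
Qed.

Lemma atom_weight_ge0 n : 0 <= riemannR (1 + 4^-1 : R) n.
Proof. by rewrite ltW// riemannR_gt0// addr_ge0// invr_ge0. Qed.

(** Any exponent s with 1 < s < 3/2 would do: the weights are summable, while
    N^(1/2) times N atoms of weight about N^(-s) still tends to infinity.
    Here s = 5/4. *)
Definition atom_weight n : {nonneg R} := NngNum (atom_weight_ge0 n).

End atoms.

(** * The measure, its moments and its quantization error *)

Section heavy_tailed_measure.
Variable R : realType.

Definition heavy_tailed_measure : set (hyp_plane R) -> \bar R :=
  atomic_measure (@atom_weight R) (@atom R).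

HB.instance Definition _ := Measure.on heavy_tailed_measure.

Lemma heavy_tailed_measure_fin : fin_num_fun heavy_tailed_measure.
Proof.
apply: lty_fin_num_fun.
rewrite [X in (X < _)%E](atomic_measure_setT (@atom_weight R) (@atom R)).
by apply: riemannR_summable; rewrite invr_gt0.
Qed.

HB.instance Definition _ :=
  Measure_isFinite.Build _ _ _ heavy_tailed_measure heavy_tailed_measure_fin.

(** The p-th power of the distance to the atom [n] is at most a multiple of
    exp (e (2 ln (n + 1))) = (n + 1) ^ (2 e), for any e > 0.  The choice
    e = 1/16 takes only the exponent 1/8 away from the weights, which leaves
    9/8 > 1. *)
Lemma heavy_tailed_moment (p : R) (x0 : hyp_plane R) : 0 < p ->
  (\int[heavy_tailed_measure]_x (hyp_dist x x0 `^ p)%:E < +oo)%E.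
Proof.
move=> p0; apply: le_lt_trans.
  by apply: le_integral_atomic_measure => y; rewrite lee_fin powR_ge0.
have [C dC] := hyp_dist_atom_le x0.
pose e : R := 16^-1; have e0 : 0 < e by rewrite invr_gt0.
pose K := (p / e) `^ p * expR (e * C).
have K0 : 0 <= K by rewrite mulr_ge0 ?powR_ge0 ?expR_ge0.
apply: (@le_lt_trans _ _
  (\sum_(0 <= n <oo) K%:E * (riemannR (1 + 8^-1) n)%:E)%E); last first.
  rewrite nneseriesZl; last first.
    by move=> n _; rewrite lee_fin ltW// riemannR_gt0// addr_ge0// invr_ge0.
  by rewrite lte_mul_pinfty ?lee_fin// riemannR_summable// invr_gt0.
apply: lee_nneseries => [n _ _|n _].
  by rewrite lee_fin mulr_ge0 ?powR_ge0.
rewrite -!EFinM lee_fin /= /riemannR.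
have n0 : 0 < n.+1%:R :> R by rewrite ltr0n.
have dK : hyp_dist (atom R n) x0 `^ p <= K * n.+1%:R `^ 8^-1.
  rewrite (le_trans (powR_le_expR (hyp_dist_ge0 _ _) p0 e0))//.
  rewrite /K -mulrA ler_wpM2l ?powR_ge0// [n.+1%:R `^ _]/powR gt_eqF//.
  rewrite -expRD ler_expR (le_trans (ler_wpM2l (ltW e0) (dC n)))//.
  by rewrite mulrDr lerD2l /e; lra.
rewrite (le_trans (ler_wpM2l _ dK)) ?invr_ge0 ?powR_ge0//.
rewrite mulrCA ler_wpM2l//.
have -> : (1 + 4^-1 : R) = (1 + 8^-1) + 8^-1 by lra.
rewrite powRD ?(gt_eqF n0) ?implybT// invfM -mulrA mulVf ?mulr1//.
Qed.

Definition uncovered (alpha : {fset hyp_plane R}) (n : nat) : bool :=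
  all (fun a => separation R <= hyp_dist a (atom R n)) alpha.

(** Choosing for each covered atom a centre close to it is injective by
    [atom_separated], so that at most N of the first 2N atoms are covered. *)
Lemma uncovered_atoms (N : nat) (alpha : {fset hyp_plane R}) :
  (#|` alpha| <= N)%N ->
  (N <= \sum_(0 <= n < N.*2 | uncovered alpha n) 1)%N.
Proof.
move=> aN; pose P := uncovered alpha.
rewrite big_mkord sum1_card -[X in (_ <= X)%N]/#|[pred n : 'I_N.*2 | P n]|.
have close (n : 'I_N.*2) : ~~ P n ->
    exists a : alpha, hyp_dist (val a) (atom R n) < separation R.
  by move=> /allPn[a aalpha]; rewrite -ltNge => ?; exists [` aalpha]%fset.
have [/eqP ->//|N0] := boolP (N == 0).
have [a0 _|no] := pickP (@predT alpha); last first.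
  suff -> : #|[pred n : 'I_N.*2 | P n]| = N.*2 by rewrite -addnn leq_addr.
  rewrite -[RHS]card_ord; apply: eq_card => n; rewrite !inE.
  have [//|/close[a _]] := boolP (P n).
  by have := no a.
pose f (n : 'I_N.*2) : alpha :=
  odflt a0 [pick a : alpha | hyp_dist (val a) (atom R n) < separation R].
have fP (n : 'I_N.*2) : ~~ P n -> hyp_dist (val (f n)) (atom R n) < separation R.
  move=> /close[a an]; rewrite /f; case: pickP => //= /(_ a).
  by rewrite an.
have inj : {in [pred n : 'I_N.*2 | ~~ P n] &, injective f}.
  move=> n m; rewrite !inE => /fP fn /fP fm fnm; apply/eqP/negPn/negP => nm.
  have := atom_separated nm fn; rewrite fnm leNgt => /negP; exact.
have := leq_card_in _ _ inj; rewrite -cardfE => /leq_trans/(_ aN).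
have := cardC [pred n : 'I_N.*2 | P n]; rewrite card_ord.
move=> cPN cN; rewrite -(leq_add2r N) addnn -[leqLHS]cPN leq_add2l.
by apply: leq_trans cN; apply/eq_leq/eq_card => n; rewrite !inE.
Qed.

(** The N uncovered atoms among the first 2N each weigh at least (2N) ^ (- 5/4)
    and contribute at least [separation] to the power r. *)
Lemma quantization_error_ge (N : nat) (r : R) : 1 <= r ->
  ((separation R `^ r * (N%:R * (N.*2%:R `^ (1 + 4^-1))^-1))%:E <=
    quantization_error N r heavy_tailed_measure)%E.
Proof.
move=> r1; apply: le_ereal_inf_tmp => _ [alpha [_ aN] <-].
pose P := uncovered alpha.
have min_ge y (k : \bar R) :
    (forall a, a \in alpha -> k <= (hyp_dist a y `^ r)%:E)%E ->
    (k <= \big[Order.min/+oo]_(a <- alpha) (hyp_dist a y `^ r)%:E)%E.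
  by move=> ka; rewrite big_seq; apply: le_bigmin => //; rewrite leey.
apply: le_trans; last first.
  apply: (@ge_integral_atomic_measure _ _ _ _ _ _ (separation R `^ r) P N.*2).
  - exact: measurable_atom.
  - by move=> y; apply: min_ge => a _; rewrite lee_fin powR_ge0.
  - exact: powR_ge0.
  - move=> n _ /allP Pn; apply: min_ge => a /Pn sa.
    rewrite lee_fin ge0_ler_powR ?nnegrE ?hyp_dist_ge0//.
      by rewrite (le_trans _ r1).
    exact/ltW/separation_gt0.
rewrite -EFinM lee_fin ler_wpM2l ?powR_ge0//.
apply: (@le_trans _ _
  (\sum_(0 <= n < N.*2 | P n) (N.*2%:R `^ (1 + 4^-1))^-1)).
  have -> : \sum_(0 <= n < N.*2 | P n) (N.*2%:R `^ (1 + 4^-1))^-1 =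
      (\sum_(0 <= n < N.*2 | P n) 1)%N%:R * (N.*2%:R `^ (1 + 4^-1))^-1 :> R.
    by rewrite natr_sum mulr_suml; apply: eq_bigr => n _; rewrite mul1r.
  by rewrite ler_wpM2r ?invr_ge0 ?powR_ge0// ler_nat uncovered_atoms.
rewrite big_nat_cond [leRHS]big_nat_cond.
apply: ler_sum => n /andP[/andP[_ nN] _].
rewrite /= lef_pV2 ?posrE ?powR_gt0 ?ltr0n ?(leq_ltn_trans _ nN)//.
by rewrite ge0_ler_powR ?nnegrE ?addr_ge0 ?invr_ge0// ler_nat.
Qed.

Lemma quantization_error_heavy_tailed (r : R) : 1 <= r ->
  ((fun N : nat =>
      ((N%:R `^ (r / 2))%:E * quantization_error N r heavy_tailed_measure)%E)
    @ \oo --> +oo%E).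
Proof.
move=> r1; apply/cvgeyPge => A.
pose c := separation R `^ r / 2 `^ (1 + 4^-1).
have c0 : 0 < c by rewrite divr_gt0 ?powR_gt0// separation_gt0.
near=> N.
have N1 : 1 <= N%:R :> R.
  by near: N; exact: nbhs_infty_ger.
have NA : (`|A| / c) ^+ 4 <= N%:R by near: N; exact: nbhs_infty_ger.
have N0 : 0 < N%:R :> R by rewrite (lt_le_trans ltr01).
apply: le_trans (lee_wpmul2l _ (quantization_error_ge N r1)); last first.
  by rewrite lee_fin powR_ge0.
rewrite -EFinM lee_fin.
have NAc : `|A| / c <= N%:R `^ 4^-1.
  have Ac0 : 0 <= `|A| / c by rewrite divr_ge0// ltW.
  rewrite -[leLHS](_ : ((`|A| / c) ^+ 4) `^ 4^-1 = _).
    by rewrite ge0_ler_powR ?nnegrE ?exprn_ge0 ?invr_ge0.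
  by rewrite -powR_mulrn// -powRrM mulfV// powRr1.
have NE : N%:R * (N.*2%:R `^ (1 + 4^-1))^-1 =
    (2 `^ (1 + 4^-1) * N%:R `^ 4^-1)^-1 :> R.
  rewrite -muln2 natrM powRM// [N%:R `^ (1 + _)]powRD ?(gt_eqF N0) ?implybT//.
  rewrite powRr1 ?(ltW N0)//; field.
  by rewrite !gt_eqF ?powR_gt0.
rewrite NE.
have Nr : N%:R `^ 4^-1 * N%:R `^ 4^-1 <= N%:R `^ (r / 2).
  rewrite -powRD ?(gt_eqF N0) ?implybT// ler_powR//; lra.
have N4 : 0 < N%:R `^ 4^-1 :> R by rewrite powR_gt0.
apply: (le_trans (ler_norm A)); rewrite -(divfK (lt0r_neq0 c0) `|A|).
apply: (@le_trans _ _ (N%:R `^ 4^-1 * c)); first by rewrite ler_pM2r.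
have -> : N%:R `^ (r / 2) * (separation R `^ r *
    (2 `^ (1 + 4^-1) * N%:R `^ 4^-1)^-1) = N%:R `^ (r / 2) / N%:R `^ 4^-1 * c.
  by rewrite /c; field; rewrite !gt_eqF ?powR_gt0.
by rewrite ler_pM2r// ler_pdivlMr.
Unshelve. all: by end_near. Qed.

End heavy_tailed_measure.

Theorem theorem1p7 (R : realType) (r : R) (hr : 1 <= r) :
  exists mu : {finite_measure set (hyp_plane R) -> \bar R},
    (forall (p : R) (x0 : hyp_plane R), 0 < p ->
       (\int[mu]_x (hyp_dist x x0 `^ p)%:E < +oo)%E) /\
    ((fun N : nat =>
        ((N%:R `^ (r / 2))%:E * quantization_error N r mu)%E) @ \oo --> +oo%E).
Proof.
exists (@heavy_tailed_measure R); split=> [p x0 p0|].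
  exact: heavy_tailed_moment.
exact: quantization_error_heavy_tailed.
Qed.
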